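(* Suppose $Z(t)$, $t\ge0$, is a stochastic process with regenerative increments over the renewal times $T_n$ such that $\mathbb{E}[T_1]$ and $\mathbb{E}[Z(T_1)]$ are finite. Let $a:=\mathbb{E}[Z(T_1)]/\mathbb{E}[T_1]$ and $M_1:=\sup_{0\le t\le T_1}|Z(t)|$. Then the strong law of large numbers, $Z(t)/t\to a$ almost surely as $t\to\infty$, holds if and only if $\mathbb{E}[M_1]<\infty$.
   Context: Renewal times: $T_0:=0$ and $T_n:=\sum_{i=1}^n\xi_i$ for $n\ge 1$, where $(\xi_i)_{i\ge1}$ are i.i.d. strictly positive random variables (so $0<T_1<T_2<\cdots$ and $\xi_n=T_n-T_{n-1}$). $Z=(Z(t))_{t\ge0}$ is a real-valued stochastic process with continuous time parameter $t\in[0,\infty)$ and càdlàg (right-continuous with left limits) paths. The process $Z(t)$ has regenerative increments over the times $T_n$ if $Z(0)=0$ and the increments $$\zeta_n:=\bigl(\xi_n,\ \{Z(t+T_{n-1})-Z(T_{n-1}):0\le t\le\xi_n\}\bigr),\qquad n\ge1,$$ are i.i.d. Here the second component, defined on the random interval $[0,\xi_n]$, is regarded as a process on $[0,\infty)$ stopped at $\xi_n$, i.e. equal to $Z(\xi_n+T_{n-1})-Z(T_{n-1})$ for all $t\ge\xi_n$, so it is a random càdlàg function on $[0,\infty)$. *)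

(* Defs.v *)
From mathcomp Require Import all_boot all_order all_algebra.
From mathcomp Require Import finmap.
From mathcomp Require Import all_classical all_reals all_analysis.
Import Order.TTheory GRing.Theory Num.Theory.
Import numFieldNormedType.Exports.

Set Implicit Arguments.
Unset Strict Implicit.
Unset Printing Implicit Defensive.

Local Open Scope classical_set_scope.
Local Open Scope ring_scope.

(* Processes indexed by [0, oo) are represented by functions on the whole of R;
   their values at negative times are junk and play no role below. *)

Definition cadlag (R : realType) (f : R -> R) : Prop :=
  (forall t : R, 0 <= t -> f x @[x --> t^'+] --> f t) /\
  (forall t : R, 0 < t -> cvg (f x @[x --> t^'-])).

(* Paths [0, oo) -> R with the sigma-algebra generated by the evaluations at
   the times t >= 0. Its trace on D[0, oo) is the Borel sigma-algebra of the
   Skorokhod J1 topology, so for cadlag random elements laws and independence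
   are the same here as in D[0, oo). *)
Definition evaluation_cylinders (R : realType) : set (set (R -> R)) :=
  [set A | exists t : R, exists B : set R,
     [/\ 0 <= t, measurable B & A = [set f : R -> R | B (f t)]]].

Notation path_space R := (g_sigma_algebraType (@evaluation_cylinders R)).

(* In the next three definitions the X i are meant to be random elements, i.e.
   measurable maps from T to U. *)
Definition mutually_independent (R : realType) (d d' : measure_display)
    (T : measurableType d) (U : measurableType d') (P : probability T R)
    (X : nat -> T -> U) : Prop :=
  forall (J : {fset nat}) (B : nat -> set U),
    (forall i, i \in J -> measurable (B i)) ->
    P (\bigcap_(i in [set` J]) (X i @^-1` B i)) =
    (\prod_(i <- J) P (X i @^-1` B i))%E.

Definition identically_distributed (R : realType) (d d' : measure_display)
    (T : measurableType d) (U : measurableType d') (P : probability T R)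
    (X : nat -> T -> U) : Prop :=
  forall (i j : nat) (B : set U), measurable B ->
    P (X i @^-1` B) = P (X j @^-1` B).

Definition iid (R : realType) (d d' : measure_display)
    (T : measurableType d) (U : measurableType d') (P : probability T R)
    (X : nat -> T -> U) : Prop :=
  mutually_independent P X /\ identically_distributed P X.

(* Indices are shifted by one: xi n is the (n+1)-st interarrival time, so that
   renewal_time xi 0 = 0 and renewal_time xi 1 = xi 0. *)
Definition renewal_time (R : realType) (T : Type) (xi : nat -> T -> R)
    (n : nat) (w : T) : R :=
  \sum_(i < n) xi i w.

Definition interarrival_times (R : realType) (d : measure_display)
    (T : measurableType d) (P : probability T R)
    (xi : nat -> {RV P >-> R}) : Prop :=
  (forall n w, 0 < xi n w) /\ iid P (fun n => xi n : T -> R).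

(* The n-th cycle (again counted from 0): its length and the increment of Z
   over it, stopped at the end of the cycle. When Z has cadlag paths this is a
   measurable map, since Z is then jointly measurable in (t, w). *)
Definition cycle_increment (R : realType) (T : Type) (xi : nat -> T -> R)
    (Z : R -> T -> R) (n : nat) (w : T) : R * path_space R :=
  (xi n w,
   fun t : R => Z (Num.min t (xi n w) + renewal_time xi n w) w
                - Z (renewal_time xi n w) w).

Definition regenerative_increments (R : realType) (d : measure_display)
    (T : measurableType d) (P : probability T R)
    (xi : nat -> {RV P >-> R}) (Z : R -> {RV P >-> R}) : Prop :=
  (forall w, Z 0 w = 0) /\
  iid P (cycle_increment (fun n => xi n : T -> R) (fun t => Z t : T -> R)).

(* Extended-real valued, so that the supremum needs no boundedness proviso. *)
Definition first_cycle_max (R : realType) (T : Type) (xi : nat -> T -> R)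
    (Z : R -> T -> R) (w : T) : \bar R :=
  ereal_sup [set (`|Z t w|)%:E | t in `[0, renewal_time xi 1 w]].

(* Main.v *)
Require Import Defs.
From mathcomp Require Import all_boot all_order all_algebra.
From mathcomp Require Import finmap ring lra.
From mathcomp Require Import all_classical all_reals all_analysis.
From mathcomp Require Import measurable_realfun.
Import Order.TTheory GRing.Theory Num.Theory.
Import numFieldNormedType.Exports.

(** Write mu for the mean cycle length, W_n for the increment of Z over the
    n-th cycle and M_n for the largest displacement of Z from its value at the
    start of that cycle. The pairs (cycle length, stopped path) are i.i.d., and
    W_n and M_n are measurable functions of them, so the W_n are i.i.d., the M_n
    are i.i.d., and M_0 is the M_1 of the theorem.

    If M_0 is integrable, the strong law gives T_n / n --> mu, and
    Z(T_n) / n --> E[W_0] because Z(T_n) is the sum of the first n increments.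
    It also gives M_n / n --> 0, since the general term of a sequence with
    convergent averages is negligible compared with n. Between T_n and T_(n+1)
    the path stays within M_n of Z(T_n), so it follows its values at the renewal
    times, and Z(t) / t --> E[W_0] / mu (cvg_of_cycle_endpoints).

    Conversely, if Z(t) / t converges then |Z(t)| grows at most linearly in t and
    T_n at most linearly in n, so that almost surely M_n <= C (n + 1) for all
    large n, with C not depending on the path (cycle_oscillation_linear). By
    independence the second Borel-Cantelli lemma makes the probabilities of
    M_n > C (n + 1) summable (borel_cantelli_indep); as the M_n have the same
    law, this is a bound on the tail sum of M_0, hence on its expectation
    (integral_lty_tail_sum).

    The strong law itself is proved along the lines of Etemadi, from pairwise
    independence. For X_i >= 0, truncating the first k variables at level k and
    applying the Chebyshev inequality bounds the probability of a deviation of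
    S_k / k by a constant times E[min(X_0, k)^2 / k]
    (truncated_mean_deviation). Over k = l, 2 l, 4 l, ... these terms add up to
    at most 4 E[X_0] (dyadic_truncated_square_le), so S_k / k converges along
    each such sequence. Since S is nondecreasing and, for l between m and 2 m,
    the numbers l 2^j leave gaps of relative size at most 1 / m, the whole
    sequence converges (cvg_average_dyadic). *)

Set Implicit Arguments.
Unset Strict Implicit.
Unset Printing Implicit Defensive.

Local Open Scope classical_set_scope.
Local Open Scope ring_scope.

(** * Independence and identical distribution *)

Section independence.
Context (R : realType) (d d' : measure_display).
Context (T : measurableType d) (U : measurableType d') (P : probability T R).

Lemma iid_comp d'' (V : measurableType d'') (X : nat -> T -> U) (f : U -> V) :
  measurable_fun setT f -> iid P X -> iid P (fun n => f \o X n).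
Proof.
move=> mf [indX idX].
have mpre B : measurable B -> measurable (f @^-1` B).
  by move=> mB; rewrite -[_ @^-1` _]setTI; exact: mf.
split=> [J B mB|i j B mB]; last exact: (idX i j _ (mpre _ mB)).
by apply: (indX J (fun i => f @^-1` B i)) => i iJ; exact/mpre/mB.
Qed.

(** The product rule for the two-element subfamily {i, j}. *)
Lemma iid_pair (X : nat -> T -> U) (i j : nat) (A B : set U) :
  iid P X -> i != j -> measurable A -> measurable B ->
  P (X i @^-1` A `&` X j @^-1` B) = (P (X i @^-1` A) * P (X j @^-1` B))%E.
Proof.
move=> [indX _] ij mA mB.
have := indX [fset i; j]%fset (fun k => if k == i then A else B).
rewrite big_fsetU1 ?inE//= big_seq_fset1 eqxx [in j == i]eq_sym (negbTE ij) => <-.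
  congr (P _); apply/seteqP; split=> w /=.
    move=> [Xi Xj] k /=; rewrite !inE => /orP[]/eqP ->; first by rewrite eqxx.
    by rewrite eq_sym (negbTE ij).
  move=> XAB; split.
    by have := XAB i; rewrite /= eqxx; apply; rewrite !inE eqxx.
  have := XAB j; rewrite /= eq_sym (negbTE ij); apply.
  by rewrite !inE eqxx orbT.
by move=> k _; case: ifP.
Qed.

Lemma iid_integral (X : nat -> {mfun T >-> U}) (f : U -> \bar R) (i j : nat) :
  iid P (fun n => X n : T -> U) ->
  measurable_fun [set: U] f -> (forall u, 0 <= f u)%E ->
  (\int[P]_w f (X i w) = \int[P]_w f (X j w))%E.
Proof.
move=> [_ idX] mf f0.
transitivity (\int[distribution P (X i)]_y f y)%E.
  by rewrite ge0_integral_distribution.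
rewrite (eq_measure_integral (distribution P (X j))) => [|A mA _].
  by rewrite ge0_integral_distribution.
exact: idX.
Qed.

End independence.

(** The product rule says that the law of the pair (X, Y) is the product of the
    laws, so this is Tonelli's theorem. The integrand is taken to be |x| |y|, which
    is nonnegative on the whole plane and not only on the range of (X, Y). *)
Lemma expectation_mul_indep (R : realType) d (T : measurableType d)
    (P : probability T R) (X Y : {RV P >-> R}) :
  (forall w, 0 <= X w) -> (forall w, 0 <= Y w) ->
  (forall A B : set R, measurable A -> measurable B ->
    P (X @^-1` A `&` Y @^-1` B) = P (X @^-1` A) * P (Y @^-1` B))%E ->
  ('E_P[(X : T -> R) * Y] = 'E_P[X] * 'E_P[Y])%E.
Proof.
move=> X0 Y0 indXY.
have mXY : measurable_fun setT (fun w => (X w, Y w)).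
  by apply/measurable_fun_pairP; split; exact: measurable_funPT.
pose f (z : R * R) : \bar R := (`|z.1|%:E * `|z.2|%:E)%E.
have mf : measurable_fun setT f.
  apply: emeasurable_funM; apply/measurable_EFinP; apply: measurableT_comp => //.
have f0 z : (0 <= f z)%E by rewrite mule_ge0// lee_fin.
have mabs : measurable_fun setT (fun x : R => `|x|%:E).
  by apply/measurable_EFinP.
have distE (V : {RV P >-> R}) : (forall w, 0 <= V w) ->
    (\int[distribution P V]_y `|y|%:E = 'E_P[V])%E.
  move=> V0; rewrite ge0_integral_distribution// unlock.
  by apply: eq_integral => w _ /=; rewrite ger0_norm.
have -> : ('E_P[(X : T -> R) * Y] = \int[pushforward P (fun w => (X w, Y w))]_z f z)%E.
  rewrite ge0_integral_pushforward// unlock.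
  by apply: eq_integral => w _; rewrite /f /= -EFinM !ger0_norm.
have -> : (\int[pushforward P (fun w => (X w, Y w))]_z f z =
    \int[distribution P X \x distribution P Y]_z f z)%E.
  apply: eq_measure_integral => A mA _; apply/esym.
  by apply: product_measure_unique => // B C mB mC; exact: indXY.
rewrite fubini_tonelli1// /fubini_F /f /=.
under eq_integral do rewrite ge0_integralZl ?distE//.
by rewrite ge0_integralZr ?distE// ?unlock; apply: integral_ge0 => w _; rewrite lee_fin.
Qed.

(** * Moments of truncated variables *)

(** The terms with c 2^j <= x equal c 2^j and form a geometric sum dominated by
    its last term; the others equal x^2 / (c 2^j) and form a geometric sum
    dominated by its first term. *)
Lemma dyadic_truncated_square_le (R : realType) (x c : R) (J : nat) :
  0 <= x -> 0 < c ->
  \sum_(j < J) Num.min x (c * 2 ^+ j) ^+ 2 / (c * 2 ^+ j) <= 4 * x.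
Proof.
move=> x0.
have shift (e : R) n : \sum_(j < n) Num.min x (e * 2 ^+ j.+1) ^+ 2 / (e * 2 ^+ j.+1)
    = \sum_(j < n) Num.min x (2 * e * 2 ^+ j) ^+ 2 / (2 * e * 2 ^+ j).
  by apply: eq_bigr => j _; rewrite (exprS _ j) mulrCA mulrA.
have below n : forall e, 0 < e -> x <= e ->
    \sum_(j < n) Num.min x (e * 2 ^+ j) ^+ 2 / (e * 2 ^+ j) <= 2 * (x ^+ 2 / e).
  elim: n => [|n IH] e e0 xe.
    by rewrite big_ord0 mulr_ge0// divr_ge0// ?sqr_ge0// ltW.
  rewrite big_ord_recl expr0 mulr1 min_l//= shift.
  have e2 : 0 < 2 * e by rewrite mulr_gt0.
  have xe2 : x <= 2 * e by lra.
  apply: le_trans (lerD (lexx _) (IH _ e2 xe2)) _.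
  have -> : x ^+ 2 / (2 * e) = x ^+ 2 / e / 2.
    by field; rewrite ?gt_eqF//.
  by lra.
(* While 2 e <= x, the leading term e is paid for by the drop of the bound from
   4 x - e to 4 x - 2 e. *)
have above n : forall e, 0 < e -> e <= x ->
    \sum_(j < n) Num.min x (e * 2 ^+ j) ^+ 2 / (e * 2 ^+ j) <= 4 * x - e.
  elim: n => [|n IH] e e0 ex; first by rewrite big_ord0; lra.
  rewrite big_ord_recl expr0 mulr1 min_r//= shift expr2 mulfK ?gt_eqF//.
  have e2 : 0 < 2 * e by rewrite mulr_gt0.
  case: (leP (2 * e) x) => [ex2|/ltW xe2].
    by apply: le_trans (lerD (lexx _) (IH _ e2 ex2)) _; lra.
  apply: le_trans (lerD (lexx _) (below n _ e2 xe2)) _.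
  have -> : 2 * (x ^+ 2 / (2 * e)) = x ^+ 2 / e.
    by field; rewrite ?gt_eqF//.
  have : x ^+ 2 / e <= 4 * x - 2 * e; last by lra.
  by rewrite ler_pdivrMr//; nra.
move=> c0; case: (leP c x) => [cx|/ltW xc].
  by apply: le_trans (above J _ c0 cx) _; lra.
apply: le_trans (below J _ c0 xc) _.
have : x ^+ 2 / c <= x; last by lra.
by rewrite ler_pdivrMr//; nra.
Qed.

Lemma bounded_Lfun2 (R : realType) (d : measure_display) (T : measurableType d)
    (P : probability T R) (f : T -> R) (C : R) :
  measurable_fun [set: T] f -> (forall w, `|f w| <= C) -> f \in Lfun P 2%:E.
Proof.
move=> mf fC; rewrite inE /=; apply/andP; split; rewrite inE//=.
rewrite /finite_norm unlock poweR_lty//.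
apply: (@le_lt_trans _ _ (\int[P]_w (C `^ 2)%:E)%E).
  apply: ge0_le_integral => //=.
  - apply/measurable_EFinP; apply: (measurableT_comp (measurable_powR 2)).
    exact: (measurableT_comp (@normr_measurable R setT) mf).
  - move=> w _; rewrite lee_fin ge0_ler_powR// nnegrE//.
    exact: le_trans (fC w).
by rewrite integral_cst//= probability_setT mule1 ltry.
Qed.

Lemma variance_sum_uncorrelated (R : realType) (d : measure_display)
    (T : measurableType d) (P : probability T R) (Y : nat -> T -> R) (n : nat) :
  (forall i, Y i \in Lfun P 2%:E) ->
  (forall i j, (i < j)%N -> covariance P (Y i) (Y j) = 0%E) ->
  'V_P[\sum_(i < n) Y i]%R = (\sum_(i < n) 'V_P[Y i])%E.
Proof.
move=> Y2 covY.
have S2 m : \sum_(i < m) Y i \in Lfun P 2%:E.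
  by apply: rpred_sum => // *; rewrite lee1n.
have covS j m : (m <= j)%N -> covariance P (\sum_(i < m) Y i) (Y j) = 0%E.
  elim: m => [_|m IH mj].
    by rewrite big_ord0; exact: (covariance_cst_l _ 0).
  by rewrite big_ord_recr covarianceDl// IH 1?ltnW// covY// adde0.
elim: n => [|n IH]; first by rewrite !big_ord0; exact: (variance_cst _ 0).
by rewrite !big_ord_recr varianceD// IH covS// mule0 adde0.
Qed.

Section truncation.
Context (R : realType) (d : measure_display) (T : measurableType d).
Context (P : probability T R) (X : nat -> {RV P >-> R}).
Hypothesis iidX : iid P (fun n => X n : T -> R).
Hypothesis X_ge0 : forall n w, 0 <= X n w.

Let trunc (c : R) (i : nat) (w : T) : R := Num.min (X i w) c.

Let measurable_trunc c i : measurable_fun [set: T] (trunc c i).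
Proof. by apply: measurable_minr. Qed.

Let trunc_bounded c i w : 0 <= c -> `|trunc c i w| <= c.
Proof.
move=> c0; rewrite ger0_norm; first by rewrite ge_min lexx orbT.
by rewrite le_min X_ge0.
Qed.

(** A deviation needs either some X_i > k with i < k, or a deviation of the sum of
    the Y_i = min(X_i, k). With h = E[min(X_0, k)^2 / k], the first event has
    probability at most k P(X_0 > k) <= h, because the integrand of h equals k
    where X_0 > k. The second has probability at most
    k Var(Y_0) / (e k)^2 <= h / e^2, by Chebyshev and pairwise independence. *)
Lemma truncated_mean_deviation (k : nat) (e : R) : (0 < k)%N -> 0 < e ->
  (P [set w | (e <= `|(\sum_(i < k) X i w) / k%:R -
                      fine 'E_P[fun w => Num.min (X 0 w) k%:R]|)%R] <=
   (1 + e ^- 2)%:E * \int[P]_w (Num.min (X 0 w) k%:R ^+ 2 / k%:R)%:E)%E.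
Proof.
move=> k0 e0; pose c : R := k%:R.
have c0 : 0 < c by rewrite ltr0n.
have c0W := ltW c0.
pose Y i : {RV P >-> R} := mfun_Sub (mem_set (measurable_trunc c i)).
have YE i : (Y i : T -> R) = trunc c i by [].
have Y2 i : (Y i : T -> R) \in Lfun P 2%:E.
  rewrite YE; apply: (@bounded_Lfun2 _ _ _ _ _ c) => // w.
  exact: trunc_bounded.
have Y1 i : (Y i : T -> R) \in Lfun P 1.
  by apply: (Lfun_subset12 _ (Y2 i)); rewrite fin_num_measure.
have Y_ge0 i w : 0 <= Y i w by rewrite YE le_min X_ge0.
have mminc : measurable_fun [set: R] (fun x : R => Num.min x c).
  exact: measurable_minr.
have iidY : iid P (fun n => Y n : T -> R).
  exact: (iid_comp mminc iidX).
have covY i j : (i < j)%N -> covariance P (Y i) (Y j) = 0%E.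
  move=> ij; rewrite covarianceE//; last exact: Lfun2_mul_Lfun1.
  rewrite expectation_mul_indep// ?subee ?fin_numM ?expectation_fin_num//.
  by move=> A B mA mB; apply: iid_pair => //; rewrite ltn_eqF.
have EY i : ('E_P[Y i] = 'E_P[Y 0%N])%E.
  rewrite unlock.
  transitivity (\int[P]_w (`|Y i w|%:E))%E.
    by apply: eq_integral => w _; rewrite ger0_norm.
  rewrite (iid_integral (f := fun x : R => `|x|%:E) i 0 iidY)//.
    by apply: eq_integral => w _; rewrite ger0_norm.
  exact/measurable_EFinP.
have EYsq i : ('E_P[(Y i : T -> R) ^+ 2] = 'E_P[(Y 0%N : T -> R) ^+ 2])%E.
  rewrite unlock.
  apply: (iid_integral (f := fun x : R => (x ^+ 2)%:E) i 0 iidY).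
  - by apply/measurable_EFinP; exact: exprn_measurable.
  - by move=> x; rewrite lee_fin sqr_ge0.
have mS : measurable_fun [set: T] (fun w => \sum_(i < k) Y i w).
  by apply: measurable_sum => i; exact: measurable_funPT.
pose S : {RV P >-> R} := mfun_Sub (mem_set mS).
have SE : (S : T -> R) = \sum_(i < k) (Y i : T -> R).
  by apply/funext => w; rewrite fct_sumE.
pose m : R := fine 'E_P[Y 0%N]%E.
pose q : R := fine 'E_P[(Y 0%N : T -> R) ^+ 2]%E.
have mE : ('E_P[Y 0%N] = m%:E)%E by rewrite fineK// expectation_fin_num.
have qE : ('E_P[(Y 0%N : T -> R) ^+ 2] = q%:E)%E.
  by rewrite fineK// expectation_fin_num//; exact: Lfun2_mul_Lfun1.
have ES : fine 'E_P[S]%E = c * m.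
  have EY' i : (\int[P]_w (Y i w)%:E = m%:E)%E by rewrite -mE -(EY i) unlock.
  rewrite unlock.
  under eq_integral do rewrite -sumEFin.
  rewrite ge0_integral_sum//.
  - by under eq_bigr do rewrite EY'; rewrite sumEFin sumr_const card_ord /= mulr_natl.
  - by move=> i; apply/measurable_EFinP; exact: measurable_funPT.
  - by move=> i w _; rewrite lee_fin.
have VS : ('V_P[S] <= (c * q)%:E)%E.
  rewrite SE variance_sum_uncorrelated//.
  have -> : c * q = \sum_(i < k) q by rewrite sumr_const card_ord mulr_natl.
  rewrite -sumEFin; apply: lee_sum => i _.
  have -> : ('V_P[Y i] = q%:E - m%:E ^+ 2)%E.
    by rewrite -qE -(EYsq i) -mE -(EY i); exact: varianceE.
  by rewrite lee_fin gerBl// sqr_ge0.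
pose A := [set w | e * c <= `|S w - fine 'E_P[S]%E|].
pose B := \big[setU/set0]_(i < k) [set w | c < X i w].
pose h : \bar R := (\int[P]_w (Num.min (X 0 w) c ^+ 2 / c)%:E)%E.
have hE : h = (q / c)%:E.
  rewrite mulrC EFinM -qE unlock -ge0_integralZl//.
  - by apply: eq_integral => w _; rewrite -EFinM mulrC.
  - by apply/measurable_EFinP; exact: (measurable_funX 2 (measurable_trunc c 0)).
  - by move=> w _; rewrite lee_fin sqr_ge0.
  - by rewrite lee_fin invr_ge0.
have mA : measurable A.
  rewrite -[A]setTI; apply: measurable_fun_le => //.
  by apply: measurableT_comp => //; exact: measurable_funB.
have preB i : [set w | c < X i w] = X i @^-1` `]c, +oo[.
  by apply/seteqP; split=> w; rewrite /= in_itv /= andbT.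
have mB i : measurable [set w | c < X i w].
  by rewrite preB; exact: measurable_funPTI.
have PA : (P A <= (e ^- 2)%:E * h)%E.
  apply: le_trans (chebyshev S (mulr_gt0 e0 c0)) _.
  apply: le_trans (lee_wpmul2l _ VS) _.
    by rewrite lee_fin invr_ge0 sqr_ge0.
  rewrite hE -!EFinM lee_fin le_eqVlt; apply/orP; left; apply/eqP.
  by field; rewrite !gt_eqF.
have PB : (P B <= h)%E.
  apply: (@le_trans _ _ (\sum_(i < k) P [set w | (c < X i w)%R])%E).
    exact: (@Boole_inequality _ _ _ P (fun i => [set w | c < X i w])).
  have PX (i : 'I_k) : true -> P [set w | c < X i w] = P [set w | c < X 0%N w].
    by move=> _; rewrite !preB; case: iidX => _; apply.
  rewrite (eq_bigr _ PX).
  have P0 : P [set w | c < X 0%N w] = (\int[P]_w (\1_[set w | c < X 0%N w] w)%:E)%E.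
    by rewrite integral_indic// setIT.
  have pE : P [set w | c < X 0%N w] = (fine (P [set w | c < X 0%N w]))%:E.
    by rewrite fineK// fin_num_measure.
  rewrite pE sumEFin sumr_const card_ord -mulr_natl EFinM -pE P0.
  rewrite -ge0_integralZl//.

  2: by apply/measurable_EFinP; exact: measurable_indic.
  apply: ge0_le_integral => //.
  - by apply: measurable_funeM; apply/measurable_EFinP; exact: measurable_indic.
  - apply/measurable_EFinP; apply: measurable_funM => //.
    by apply: measurable_funX; exact: measurable_trunc.
  - move=> w _; rewrite -EFinM lee_fin indicE.
    have [/set_mem /= cX|_] := boolP (w \in _); last first.
      by rewrite mulr0 divr_ge0// sqr_ge0.
    by rewrite (min_r (ltW cX)) mulr1 expr2 mulfK ?lt0r_neq0.
apply: (@le_trans _ _ (P (B `|` A))).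
  apply: le_measure; rewrite ?inE.
  - rewrite -[X in measurable X]setTI; apply: measurable_fun_le => //.
    apply: measurableT_comp => //; apply: measurable_funB => //.
    by apply: measurable_funM => //; apply: measurable_sum.
  - by apply: measurableU => //; exact: bigsetU_measurable.
  - move=> w /= dev; have [Bw|nBw] := pselect (B w); first by left.
    right; suff : e * c <= `|S w - fine 'E_P[S]%E| by [].
    rewrite ES; have -> : S w = \sum_(i < k) X i w.
      rewrite SE fct_sumE; apply: eq_bigr => i _; rewrite YE /trunc min_l// leNgt.
      apply/negP => cX; apply: nBw.
      rewrite /B -(bigcup_mkord k (fun i => [set w | c < X i w])).
      by exists i => //=.
    have -> : \sum_(i < k) X i w - c * m = c * ((\sum_(i < k) X i w) / c - m).
      by field; rewrite gt_eqF.
    by rewrite normrM (gtr0_norm c0) mulrC ler_pM2l.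
apply: le_trans (measureU2 _ _ _) _ => //.
  exact: bigsetU_measurable.
rewrite -[X in (_ <= _ * X)%E]/h EFinD ge0_muleDl ?lee_fin ?invr_ge0 ?sqr_ge0//.
by rewrite mul1e; exact: leeD.
Qed.
End truncation.

(** * The strong law of large numbers *)

(** The first Borel-Cantelli lemma, applied to e = 1 / (m + 1) for each m. *)
Lemma borel_cantelli_cvg (R : realType) (d : measure_display)
    (T : measurableType d) (P : probability T R) (X : nat -> T -> R)
    (a : nat -> R) (l : R) :
  (forall n, measurable_fun [set: T] (X n)) -> a @ \oo --> l ->
  (forall e : R, 0 < e ->
    (\sum_(0 <= n <oo) P [set w | (e <= `|X n w - a n|)%R] < +oo)%E) ->
  {ae P, forall w, X n w @[n --> \oo] --> l}.
Proof.
move=> mX al sumP.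
have : {ae P, forall w, forall m, \forall n \near \oo, `|X n w - a n| < m.+1%:R^-1}.
  apply/ae_foralln => m.
  pose F n := [set w | m.+1%:R^-1 <= `|X n w - a n|].
  have mF n : measurable (F n).
    rewrite -[F n]setTI; apply: measurable_fun_le => //.
    by apply: measurableT_comp => //; exact: measurable_funB.
  exists (lim_sup_set F); split.
  - apply: bigcap_measurableType => k _.
    by apply: bigcup_measurable => *; exact: mF.
  - by apply: lim_sup_set_cvg0 => //; apply: sumP; rewrite invr_gt0.
  - move=> w /= nearN k _; apply: contrapT => noF; apply: nearN.
    exists k => // n /= kn; rewrite ltNge; apply/negP => Fn.
    by apply: noF; exists n.
apply: filterS => w near_a.
suff : (X n w - a n) @[n --> \oo] --> 0.
  move=> Xa0; rewrite -[l]add0r.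
  rewrite (_ : (fun n => X n w) = (fun n => (X n w - a n) + a n)).
    exact: cvgD.
  by apply/funext => n; rewrite subrK.
apply/cvgr0Pnorm_lt => e e0.
have := near_infty_natSinv_lt (PosNum e0) => -[m _ /(_ m (leqnn m)) /= me].
by near=> n; apply: lt_trans me; near: n; exact: near_a.
Unshelve. all: by end_near. Qed.

(** Every large n lies between l 2^j and (l + 1) 2^j for some l in [m, 2 m). As S
    is nondecreasing, S n / n is squeezed between the averages at these two
    points, up to a factor (l + 1) / l <= 1 + 1 / m. Only finitely many l occur,
    so the convergences along the sequences l 2^j are used uniformly. *)
Lemma cvg_average_dyadic (R : realType) (S : nat -> R) (mu : R) :
  (forall n, 0 <= S n) -> {homo S : n m / (n <= m)%N >-> n <= m} ->
  (forall l, (0 < l)%N -> S (l * 2 ^ j)%N / (l * 2 ^ j)%:R @[j --> \oo] --> mu) ->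
  S n / n%:R @[n --> \oo] --> mu.
Proof.
move=> S_ge0 S_nd Scvg.
have mu0 : 0 <= mu.
  have /cvg_lim <- // := Scvg 1%N (ltn0Sn 0).
  apply: limr_ge; first by apply/cvg_ex; exists mu; exact: Scvg.
  by apply: nearW => j; rewrite divr_ge0.
apply/cvgrPdist_le => e e0.
(* The choice gives (mu + eta) (1 + eta) <= mu + e. *)
pose eta := Num.min 1 (e / (mu + 2)).
have mu2 : 0 < mu + 2 by lra.
have eta0 : 0 < eta by rewrite lt_min ltr01 divr_gt0.
have eta1 : eta <= 1 by rewrite ge_min lexx.
have etae : eta * (mu + 2) <= e by rewrite -ler_pdivlMr// ge_min lexx orbT.
have [m0 _ /(_ m0 (leqnn m0)) /= etam] := near_infty_natSinv_lt (PosNum eta0).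
pose m := m0.+1.
have Snear : \forall j \near \oo, forall l : 'I_(m * 2).+1, (0 < l)%N ->
    `|mu - S (l * 2 ^ j)%N / (l * 2 ^ j)%:R| <= eta.
  apply: filter_forall => l; have [l0|l0] := posnP l.
    by apply: nearW => j; rewrite l0.
  have /cvgrPdist_le/(_ _ eta0) := Scvg _ l0.
  by apply: filterS => j.
have [J _ SJ] := Snear.
exists (m * 2 ^ J)%N => // n /= nJ.
have n0 : (0 < n)%N by apply: leq_trans nJ; rewrite muln_gt0 expn_gt0.
have nm0 : (0 < n %/ m)%N.
  by rewrite divn_gt0// (leq_trans _ nJ)// leq_pmulr// expn_gt0.
(* Here m 2^j <= n < m 2^(j + 1), so l := n %/ 2^j lies in [m, 2 m). *)
pose j := trunc_log 2 (n %/ m).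
have /andP[jn nj] := trunc_log_bounds (isT : (1 < 2)%N) nm0.
have Jj : (J <= j)%N.
  by rewrite trunc_log_max// leq_divRL// mulnC.
pose l := (n %/ 2 ^ j)%N.
have p0 : (0 < 2 ^ j)%N by rewrite expn_gt0.
have ml : (m <= l)%N by rewrite leq_divRL// mulnC -leq_divRL.
have lm : (l < m * 2)%N by rewrite ltn_divLR// -mulnA -expnS mulnC -ltn_divLR.
have ln : (l * 2 ^ j <= n)%N by exact: leq_divM.
have nl : (n <= l.+1 * 2 ^ j)%N by rewrite ltnW// ltn_ceil.
have lo := SJ j Jj (Ordinal (leqW lm : (l < (m * 2).+1)%N)) (leq_trans (ltn0Sn _) ml).
have hi := SJ j Jj (Ordinal (lm : (l.+1 < (m * 2).+1)%N)) (ltn0Sn _).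
move: lo hi; rewrite /= !natrM.
have p0R : 0 < (2 ^ j)%:R :> R by rewrite ltr0n.
have etaL : 1 <= eta * l%:R.
  apply: (@le_trans _ _ (eta * m%:R)); last by rewrite ler_pM2l// ler_nat.
  by rewrite -ler_pdivrMr// ltW// div1r.
have L0 : 0 < l%:R :> R by rewrite ltr0n (leq_trans _ ml).
have lnR : l%:R * (2 ^ j)%:R <= n%:R :> R by rewrite -natrM ler_nat.
have nlR : n%:R <= (l%:R + 1) * (2 ^ j)%:R :> R by rewrite natr1 -natrM ler_nat.
have sa := S_nd _ _ ln; have sb := S_nd _ _ nl; have s0 := S_ge0 n.
have nR : 0 < n%:R :> R by rewrite ltr0n.
rewrite !ler_distl -natr1.
move: (2 ^ j)%:R (l%:R : R) (n%:R : R) p0R etaL L0 lnR nlR nR.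
move=> p L N p0R etaL L0 lnR nlR nR.
have Lp0 : 0 < L * p by rewrite mulr_gt0.
have L1p0 : 0 < (L + 1) * p by rewrite mulr_gt0// addr_gt0.
move=> /andP[_]; rewrite -lerBlDr ler_pdivlMr// => lo.
move=> /andP[+ _]; rewrite lerBlDr ler_pdivrMr// => hi.
have grow : (L + 1) * p <= (1 + eta) * (L * p) by nra.
apply/andP; split.
  rewrite lerBlDr ler_pdivrMr//; apply: le_trans sb (le_trans hi _).
  apply: (@le_trans _ _ ((mu + eta) * ((1 + eta) * (L * p)))).
    by rewrite ler_wpM2l// addr_ge0// ltW.
  apply: (@le_trans _ _ ((mu + e) * (L * p))); last by rewrite ler_wpM2l// addr_ge0// ltW.
  by rewrite (mulrA _ (1 + eta)) (ler_wpM2r (ltW Lp0))//; nra.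
rewrite -lerBlDr ler_pdivlMr//; have [emu|mue] := leP (mu - e) 0.
  by apply: le_trans s0; rewrite mulr_le0_ge0// ltW.
apply: le_trans (le_trans lo sa).
apply: (@le_trans _ _ ((mu - e) * ((1 + eta) * (L * p)))).
  by rewrite ler_wpM2l// ?(le_trans nlR)// ltW.
by rewrite (mulrA _ (1 + eta)) (ler_wpM2r (ltW Lp0))//; nra.
Qed.

Section slln_nonnegative.
Context (R : realType) (d : measure_display) (T : measurableType d).
Context (P : probability T R).

Lemma truncated_mean_cvg (X : {RV P >-> R}) : (forall w, 0 <= X w) ->
  P.-integrable setT (fun w => (X w)%:E) ->
  fine 'E_P[fun w => Num.min (X w) n%:R]%E @[n --> \oo] --> fine 'E_P[X]%E.
Proof.
move=> X_ge0 intX; apply: fine_cvg.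
rewrite fineK; last by rewrite expectation_fin_num//; exact/Lfun1_integrable.
rewrite unlock.
pose g (n : nat) w : \bar R := (Num.min (X w) n%:R)%:E.
have limg w : limn (g ^~ w) = (X w)%:E.
  apply/cvg_lim => //; apply: cvg_near_cst.
  exists (Num.trunc (X w)).+1 => // n /= Xn.
  by rewrite /g min_l// (le_trans (ltW (truncnS_gt _)))// ler_nat.
under [X in _ --> X]eq_integral do rewrite -limg.
apply: cvg_monotone_convergence => //.
- by move=> n; apply/measurable_EFinP; apply: measurable_minr.
- by move=> n w _; rewrite lee_fin le_min X_ge0 ler0n.
- move=> w _ m n mn; rewrite lee_fin le_min ge_min lexx /= ge_min ler_nat mn.
  by rewrite orbT.
Qed.

Context (X : nat -> {RV P >-> R}).
Hypothesis iidX : iid P (fun n => X n : T -> R).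
Hypothesis X_ge0 : forall n w, 0 <= X n w.
Hypothesis X_int : P.-integrable setT (fun w => (X 0 w)%:E).

(** The truncated means converge to the mean, and the deviation probabilities
    along k = l 2^j sum to at most (1 + e^-2) 4 E[X_0]. *)
Lemma slln_dyadic (l : nat) : (0 < l)%N ->
  {ae P, forall w, (\sum_(i < l * 2 ^ j) X i w) / (l * 2 ^ j)%:R
                   @[j --> \oo] --> fine 'E_P[X 0]%E}.
Proof.
move=> l0; pose k j := (l * 2 ^ j)%N.
have k0 j : (0 < k j)%N by rewrite muln_gt0 l0 expn_gt0.
apply: (@borel_cantelli_cvg _ _ _ _
  (fun j w => (\sum_(i < k j) X i w) / (k j)%:R)
  (fun j => fine 'E_P[fun w => Num.min (X 0 w) (k j)%:R]%E)).
- move=> j; apply: measurable_funM => //.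
  by apply: measurable_sum => i; exact: measurable_funPT.
- apply: (cvg_comp k _ _ (truncated_mean_cvg (X_ge0 0) X_int)).
  apply/cvgnyPge => A; exists A => // j /= Aj.
  apply: (leq_trans Aj); apply: (leq_trans (ltnW (ltn_expl j (isT : 1 < 2)%N))).
  by rewrite leq_pmull.
move=> e e0.
pose h j w : \bar R := (Num.min (X 0 w) (k j)%:R ^+ 2 / (k j)%:R)%:E.
have h0 j w : (0 <= h j w)%E by rewrite lee_fin divr_ge0// sqr_ge0.
have mh j : measurable_fun [set: T] (h j).
  apply/measurable_EFinP; apply: measurable_funM => //.
  by apply: measurable_funX; exact: measurable_minr.
apply: (@le_lt_trans _ _ (\sum_(0 <= j <oo) ((1 + e ^- 2)%:E * \int[P]_w h j w))%E).
  by apply: lee_nneseries => // j _; exact: truncated_mean_deviation.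
rewrite nneseriesZl; last by move=> j _; exact: integral_ge0.
rewrite -integral_nneseries//.
apply: (@le_lt_trans _ _ ((1 + e ^- 2)%:E * \int[P]_w (4%:E * (X 0 w)%:E)))%E.
  apply: lee_wpmul2l.
    by rewrite lee_fin addr_ge0// invr_ge0 sqr_ge0.
  apply: ge0_le_integral => //.
  - by move=> w _; apply: nneseries_ge0.
  - by apply: ge0_emeasurable_sum.
  - apply: measurable_funeM; apply/measurable_EFinP; exact: measurable_funPT.
  - move=> w _; apply: lime_le; first exact: is_cvg_nneseries.
    apply: nearW => J; rewrite big_mkord sumEFin -EFinM lee_fin.
    under eq_bigr do rewrite /k natrM natrX.
    by apply: dyadic_truncated_square_le => //; rewrite ltr0n.
rewrite integralZl//.
have /fineK <- : (\int[P]_w (X 0 w)%:E)%E \is a fin_num by exact: integrable_fin_num.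
by rewrite -!EFinM ltry.
Qed.

Lemma slln_ge0 :
  {ae P, forall w, (\sum_(i < n) X i w) / n%:R @[n --> \oo] --> fine 'E_P[X 0]%E}.
Proof.
have : {ae P, forall w, forall l, (\sum_(i < l.+1 * 2 ^ j) X i w) / (l.+1 * 2 ^ j)%:R
                   @[j --> \oo] --> fine 'E_P[X 0]%E}.
  by apply/ae_foralln => l; exact: slln_dyadic.
apply: filterS => w dyadic.
apply: (@cvg_average_dyadic R (fun n => \sum_(i < n) X i w)).
- by move=> n; apply: sumr_ge0.
- move=> n m nm; rewrite -(subnKC nm) big_split_ord /= lerDl.
  exact: sumr_ge0.
- by case.
Qed.

End slln_nonnegative.

(** Positive and negative parts of the X_n are again i.i.d., and the nonnegative
    case applies to each. *)
Lemma slln (R : realType) (d : measure_display) (T : measurableType d)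
    (P : probability T R) (X : nat -> {RV P >-> R}) :
  iid P (fun n => X n : T -> R) ->
  P.-integrable setT (fun w => (X 0%N w)%:E) ->
  {ae P, forall w, (\sum_(i < n) X i w) / n%:R @[n --> \oo] --> fine 'E_P[X 0%N]%E}.
Proof.
move=> iidX X_int.
(* part false is the positive part, part true the negative part. *)
pose part (s : bool) (x : R) : R := Num.max ((-1) ^+ s * x) 0.
have mpart s : measurable_fun [set: R] (part s).
  by apply: measurable_maxr => //; exact: measurable_funM.
have part_ge0 s x : 0 <= part s x by rewrite le_max lexx orbT.
have part_le s x : part s x <= `|x|.
  rewrite ge_max normr_ge0 andbT; apply: le_trans (ler_norm _) _.
  by rewrite normrM normrX normrN1 expr1n mul1r.
have partB x : x = part false x - part true x.
  by rewrite /part expr0 expr1 mul1r mulN1r; have [x0|x0] := leP 0 x;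
    [rewrite max_r ?oppr_le0// subr0|rewrite max_l ?oppr_ge0 ?ltW// sub0r opprK].
pose Y s n : {RV P >-> R} :=
  mfun_Sub (mem_set (measurableT_comp (mpart s) (@measurable_funPT _ _ _ _ (X n)))).
have iidY s : iid P (fun n => Y s n : T -> R) by exact: (iid_comp (mpart s) iidX).
have Y_int s : P.-integrable setT (fun w => (Y s 0%N w)%:E).
  apply: le_integrable X_int => //.
    by apply/measurable_EFinP; exact: measurable_funPT.
  by move=> w _; rewrite lee_fin ger0_norm ?part_ge0//; exact: part_le.
have EB : fine 'E_P[X 0%N]%E = fine 'E_P[Y false 0%N]%E - fine 'E_P[Y true 0%N]%E.
  have Y1 s : (Y s 0%N : T -> R) \in Lfun P 1 by apply/Lfun1_integrable; exact: Y_int.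
  rewrite -fineB ?expectation_fin_num// -expectationB//.
  congr (fine (expectation P _)); apply/funext => w; exact: (partB (X 0%N w)).
have Y_ge0 s n w : 0 <= Y s n w by exact: part_ge0.
have := slln_ge0 (iidY false) (Y_ge0 false) (Y_int false).
have := slln_ge0 (iidY true) (Y_ge0 true) (Y_int true).
apply: filterS2 => w cvgN cvgP; rewrite EB.
rewrite (_ : (fun n => _) = fun n => (\sum_(i < n) Y false i w) / n%:R -
                                     (\sum_(i < n) Y true i w) / n%:R).
  exact: cvgB.
apply/funext => n; rewrite -mulrBl -sumrB; congr (_ / _).
by apply: eq_bigr => i _; exact: partB.
Qed.

(** * The converse Borel-Cantelli lemma and tail sums *)

(** If the event that no B n occurs for n >= N has probability c > 0, then for
    every K independence gives
    c <= prod_(N <= n < N + K) (1 - p_n) <= exp (- sum_(N <= n < N + K) p_n),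
    which bounds the partial sums of the p_n. Such an N exists because the union
    of these events over N has probability one. *)
Lemma borel_cantelli_indep (R : realType) (d d' : measure_display)
    (T : measurableType d) (U : measurableType d') (P : probability T R)
    (X : nat -> T -> U) (B : nat -> set U) :
  mutually_independent P X -> (forall n, measurable_fun [set: T] (X n)) ->
  (forall n, measurable (B n)) ->
  {ae P, forall w, \forall n \near \oo, ~ B n (X n w)} ->
  (\sum_(0 <= n <oo) P (X n @^-1` B n) < +oo)%E.
Proof.
move=> indX mX mB aeB.
have mpre n : measurable (X n @^-1` B n).
  by rewrite -[X in measurable X]setTI; exact: mX.
pose p n : R := fine (P (X n @^-1` B n)).
have pE n : P (X n @^-1` B n) = (p n)%:E by rewrite fineK// fin_num_measure.
pose F N := \bigcap_(n >= N) ~` (X n @^-1` B n).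
have mF N : measurable (F N).
  by apply: bigcap_measurableType => n _; exact: measurableC.
have [N PN] : exists N, P (F N) != 0%E.
  apply: contrapT => /forallNP PF0.
  have : P.-negligible (\bigcup_N F N).
    by apply: negligible_bigcup => N; exists (F N); split => //;
      apply/eqP/negPn/negP; exact: PF0.
  move=> /negligibleU /(_ aeB).
  have -> : \bigcup_N F N `|` ~` [set w | \forall n \near \oo, ~ B n (X n w)] = setT.
    rewrite -subTset => w _.
    have [[N _ FN]|] := pselect (\forall n \near \oo, ~ B n (X n w)).
      by left; exists N => // n; exact: FN.
    by right.
  move=> /(negligibleP _ measurableT) PT0.
  by have := @probability_setT _ _ _ P; rewrite PT0 => /eqP; rewrite eq_sym onee_eq0.
pose c := fine (P (F N)).
have cE : P (F N) = c%:E by rewrite fineK// fin_num_measure.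
have c0 : 0 < c by rewrite lt_neqAle -lee_fin -eqe -cE measure_ge0 eq_sym PN.
have sum_le K : \sum_(N <= n < N + K) p n <= - ln c.
  pose J := [fset n in index_iota N (N + K)]%fset.
  have JE : perm_eq J (index_iota N (N + K)).
    by apply: uniq_perm => [||n]; rewrite ?fset_uniq ?iota_uniq// !inE.
  rewrite -(perm_big _ JE) /= lerNr -ler_expR lnK ?posrE//.
  rewrite -lee_fin -cE.
  apply: (@le_trans _ _ (P (\bigcap_(n in [set` J]) (X n @^-1` (~` B n))))).
    apply: le_measure; rewrite ?inE//.
      apply: fin_bigcap_measurable => // n _.
      exact: (measurableC (mpre n)).
    by move=> w FNw n /=; rewrite !inE mem_index_iota => /andP[+ _]; exact: FNw.
  rewrite indX; last by move=> n _; exact: measurableC.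
  have PC n : P (X n @^-1` (~` B n)) = (1 - p n)%:E.
    by rewrite -preimage_setC probability_setC// pE.
  rewrite (eq_bigr _ (fun n _ => PC n)).
  rewrite prodEFin lee_fin -sumrN expR_sum; apply: ler_prod => n _.
  rewrite expR_ge1Dx andbT subr_ge0 -lee_fin -pE.
  exact: probability_le1.
apply: (@le_lt_trans _ _ ((\sum_(0 <= n < N) p n) + - ln c)%:E); last exact: ltry.
apply: lime_le; first exact: is_cvg_nneseries.
exists N => // K /= NK; under eq_bigr do rewrite pE.
rewrite sumEFin lee_fin (big_cat_nat _ NK)//= lerD2l -(subnKC NK).
exact: sum_le.
Qed.

(** Pointwise, M <= C (1 + s) where s counts the n with C (n + 1) < M. *)
Lemma integral_lty_tail_sum (R : realType) (d : measure_display)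
    (T : measurableType d) (P : probability T R) (M : T -> \bar R) (C : R) :
  measurable_fun [set: T] M -> 0 < C ->
  (\sum_(0 <= n <oo) P [set w | ((C * n.+1%:R)%:E < M w)%E] < +oo)%E ->
  (forall w, 0 <= M w)%E ->
  (\int[P]_w M w < +oo)%E.
Proof.
move=> mM C0 sumP M0.
pose A n := [set w | ((C * n.+1%:R)%:E < M w)%E].
have mA n : measurable (A n).
  by rewrite -[A n]setTI; exact: emeasurable_fun_o_infty.
pose s w : \bar R := (\sum_(0 <= n <oo) (\1_(A n) w)%:E)%E.
have s0 w : (0 <= s w)%E by apply: nneseries_ge0 => n _ _; rewrite lee_fin.
have ms : measurable_fun [set: T] s.
  apply: ge0_emeasurable_sum => n *; first by rewrite lee_fin.
  by apply/measurable_EFinP; exact: measurable_indic.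
have s_ge w N : (forall n, (n < N)%N -> ((C * n.+1%:R)%:E < M w)%E) ->
    (N%:R%:E <= s w)%E.
  move=> CM; apply: le_trans (nneseries_lim_ge N _); last first.
    by move=> n _ _; rewrite lee_fin.
  rewrite sumEFin lee_fin (eq_big_nat _ _ (F2 := fun=> 1)).
    by rewrite sumr_const_nat subn0.
  by move=> n nN; rewrite indicE mem_set//; exact: CM.
have Ms w : (M w <= C%:E * (1 + s w))%E.
  have [[n Mn]|nM] := pselect (exists n, (M w <= (C * n.+1%:R)%:E)%E).
    case: (ex_minnP (ex_intro (fun n => M w <= (C * n.+1%:R)%:E)%E n Mn)) => m Mm min_m.
    apply: le_trans Mm _; rewrite EFinM lee_pmul2l//.
    rewrite -natr1 addrC EFinD leeD2l// s_ge// => k km.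
    by rewrite ltNge; apply/negP => /min_m; rewrite leqNgt km.
  have -> : s w = +oo%E.
    apply/eqyP => r r0; apply: (@le_trans _ _ (Num.trunc r).+1%:R%:E).
      by rewrite lee_fin ltW// truncnS_gt.
    apply: s_ge => n _; rewrite ltNge; apply/negP => Mn.
    by apply: nM; exists n.
  by rewrite addey// gt0_muley ?leey// lte_fin.
apply: (@le_lt_trans _ _ (\int[P]_w (C%:E * (1 + s w)))%E).
  apply: ge0_le_integral => //.
  by apply: measurable_funeM; exact: emeasurable_funD.
rewrite ge0_integralZl//; last 3 first.
- exact: emeasurable_funD.
- by move=> w _; exact: adde_ge0.
- by rewrite lee_fin ltW.
rewrite ge0_integralD// integral_cst//= probability_setT mul1e.
rewrite integral_nneseries//; last first.
  by move=> n; apply/measurable_EFinP; exact: measurable_indic.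
under eq_eseriesr do rewrite integral_indic// setIT.
have /fineK <- : (\sum_(0 <= n <oo) P (A n))%E \is a fin_num.
  by rewrite ge0_fin_numE//; exact: nneseries_ge0.
by rewrite -EFinD -EFinM ltry.
Qed.

(** * Random times and functionals of a cycle *)

Lemma measurable_fun_nat_select (R : realType) (d : measure_display)
    (T : measurableType d) (N : T -> nat) (G : nat -> T -> R) :
  (forall n, measurable (N @^-1` [set n])) ->
  (forall n, measurable_fun [set: T] (G n)) ->
  measurable_fun [set: T] (fun w => G (N w) w).
Proof.
move=> mN mG _ B mB; rewrite setTI.
rewrite (_ : _ @^-1` B = \bigcup_n (N @^-1` [set n] `&` G n @^-1` B)).
  apply: bigcupT_measurable => n; apply: measurableI => //.
  by rewrite -[X in measurable X]setTI; exact: mG.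
by apply/seteqP; split=> [w Bw|w [n _ [/= <-]]//]; exists (N w).
Qed.

Lemma measurable_trunc_fiber (R : realType) (d : measure_display)
    (T : measurableType d) (f : T -> R) (n : nat) :
  measurable_fun [set: T] f -> (forall w, 0 <= f w) ->
  measurable ((fun w => Num.trunc (f w)) @^-1` [set n]).
Proof.
move=> mf f0.
rewrite (_ : _ @^-1` _ = [set: T] `&` f @^-1` `[n%:R, n.+1%:R[%classic).
  exact: mf.
rewrite setTI; apply/seteqP; split=> w /=; rewrite in_itv /=.
  by move=> /eqP; rewrite truncn_eq.
by move=> ?; apply/eqP; rewrite truncn_eq.
Qed.

(** A multiple of 1 / (k + 1) strictly larger than t, at distance at most
    1 / (k + 1): it takes countably many values and tends to t from the right. *)
Definition upper_approx (R : realType) (k : nat) (t : R) : R :=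
  (Num.trunc (t * k.+1%:R)).+1%:R / k.+1%:R.

Lemma upper_approx_gt (R : realType) k (t : R) : t < upper_approx k t.
Proof. by rewrite ltr_pdivlMr// truncnS_gt. Qed.

Lemma upper_approx_cvg (R : realType) (t : R) : 0 <= t ->
  upper_approx k t @[k --> \oo] --> t.
Proof.
move=> t0; apply: (@squeeze_cvgr _ _ _ _ (cst t) (fun k => t + k.+1%:R^-1)).
- apply: nearW => k; rewrite (ltW (upper_approx_gt _ _)) /=.
  rewrite ler_pdivrMr// mulrDl mulVf// -natr1 lerD2r.
  by rewrite truncn_le mulr_ge0.
- exact: cvg_cst.
- by rewrite -[X in _ --> X]addr0; apply: cvgD; [exact: cvg_cst|exact: cvg_harmonic].
Qed.

Section cadlag_process.
Context (R : realType) (d : measure_display) (T : measurableType d).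

(** By right-continuity Z (tau) is the limit of Z at the approximations of tau
    from above, which take countably many values. *)
Lemma measurable_random_time (Z : R -> T -> R) (tau : T -> R) :
  (forall t, measurable_fun [set: T] (Z t)) ->
  (forall w, cadlag (fun t => Z t w)) ->
  measurable_fun [set: T] tau -> (forall w, 0 <= tau w) ->
  measurable_fun [set: T] (fun w => Z (tau w) w).
Proof.
move=> mZ cadZ mtau tau0.
apply: (@measurable_fun_cvg _ _ _ _ (fun k w => Z (upper_approx k (tau w)) w)) => [k|w _].
  apply: (measurable_fun_nat_select
    (N := fun w => Num.trunc (tau w * k.+1%:R))
    (G := fun n => Z (n.+1%:R / k.+1%:R))) => // n.
  apply: measurable_trunc_fiber; first exact: measurable_funM.
  by move=> w; rewrite mulr_ge0.
have [/(_ _ (tau0 w)) /cvg_at_rightP Zright _] := cadZ w.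
apply: Zright; split; last exact: upper_approx_cvg.
by move=> k; exact: upper_approx_gt.
Qed.

End cadlag_process.

Section path_functionals.
Context (R : realType).
Implicit Type c : R * path_space R.

Lemma measurable_evaluation (t : R) : 0 <= t ->
  measurable_fun [set: path_space R] (fun p : path_space R => p t).
Proof.
move=> t0 _ B mB; rewrite setTI; apply: sub_sigma_algebra.
by exists t, B.
Qed.

Lemma measurable_path_at (t : R) : 0 <= t ->
  measurable_fun [set: R * path_space R] (fun c => c.2 t).
Proof.
by move=> t0; apply: measurableT_comp (measurable_evaluation t0) _.
Qed.

(** The stopped path is constant after the end of the cycle, so its value at any
    integer time beyond the cycle length is the increment over the cycle. The
    absolute value makes that time nonnegative for every c. *)
Definition cycle_end (c : R * path_space R) : R := c.2 (Num.trunc `|c.1|).+1%:R.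

Lemma measurable_cycle_end : measurable_fun setT cycle_end.
Proof.
apply: (measurable_fun_nat_select
  (N := fun c : R * path_space R => Num.trunc `|c.1|)
  (G := fun n c => c.2 n.+1%:R)) => n; last exact: measurable_path_at.
apply: measurable_trunc_fiber => //.
by apply: measurableT_comp => //.
Qed.

(** The supremum of |c.2| over the nonnegative rationals, as an iterated supremum
    of sequences (esups u 0 is the supremum of u): a countable supremum is
    measurable, and for a right-continuous path it is the full supremum. *)
Definition cycle_sup (c : R * path_space R) : \bar R :=
  esups (fun k => esups (fun n => `|c.2 (n%:R / k.+1%:R)|%:E) 0) 0.

Lemma measurable_cycle_sup : measurable_fun setT cycle_sup.
Proof.
apply: measurable_fun_esups => k; apply: measurable_fun_esups => n.
apply/measurable_EFinP; apply: measurableT_comp => //.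
by apply: measurable_path_at; rewrite divr_ge0.
Qed.

Lemma cycle_sup_ge c n k : (`|c.2 (n%:R / k.+1%:R)|%:E <= cycle_sup c)%E.
Proof.
apply: (@le_trans _ _ (esups (fun n => `|c.2 (n%:R / k.+1%:R)|%:E) 0)).
  by apply: ereal_sup_ubound; exists n.
by apply: ereal_sup_ubound; exists k.
Qed.

Lemma cycle_sup_le c (B : \bar R) :
  (forall t, 0 <= t -> (`|c.2 t|%:E <= B)%E) -> (cycle_sup c <= B)%E.
Proof.
move=> cB; apply: ge_ereal_sup => _ [k _ <-].
by apply: ge_ereal_sup => _ [n _ <-]; apply: cB; rewrite divr_ge0.
Qed.

Lemma cycle_sup_ge0 c : (0 <= cycle_sup c)%E.
Proof. by apply: le_trans (cycle_sup_ge c 0 0); rewrite lee_fin. Qed.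

End path_functionals.

(** * Growth of a path and of its cycles *)

Lemma cvg_average_succ (R : realType) (u : nat -> R) (l : R) :
  u n / n%:R @[n --> \oo] --> l -> u n.+1 / n.+1%:R @[n --> \oo] --> l.
Proof.
move=> u_cvg; apply: (cvg_comp S (fun n => u n / n%:R) _ u_cvg).
by apply/cvgnyPge => A; exists A => // n; exact: leqW.
Qed.

Lemma cvg_average_shift (R : realType) (u : nat -> R) (l : R) :
  u n / n%:R @[n --> \oo] --> l -> u n.+1 / n%:R @[n --> \oo] --> l.
Proof.
move=> u_cvg.
have inv_cvg : n%:R^-1 @[n --> \oo] --> (0 : R).
  apply/gtr0_cvgV0; last exact: cvgr_idn.
  by exists 1%N => // n /= n0; rewrite ltr0n.
have prod_cvg : u n.+1 / n.+1%:R * (1 + n%:R^-1) @[n --> \oo] --> l * (1 + 0).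
  apply: cvgM; first exact: cvg_average_succ.
  by apply: cvgD => //; exact: cvg_cst.
rewrite -[l]mulr1 -[X in l * X]addr0.
apply: cvg_trans prod_cvg; apply: near_eq_cvg.
exists 1%N => // n /= n0; rewrite -natr1.
by field; rewrite natr1 !lt0r_neq0 ?ltr0n.
Qed.

(** u n is a difference of consecutive partial sums, whose quotients by n have the
    same limit. *)
Lemma cvg_average_term (R : realType) (u : nat -> R) (l : R) :
  (\sum_(i < n) u i) / n%:R @[n --> \oo] --> l -> u n / n%:R @[n --> \oo] --> 0.
Proof.
move=> avg; have := cvg_average_shift (u := fun n => \sum_(i < n) u i) avg.
move=> avgS; rewrite -[0](subrr l).
rewrite (_ : (fun n => _) = fun n => (\sum_(i < n.+1) u i) / n%:R -
                                     (\sum_(i < n) u i) / n%:R).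
  exact: cvgB.
by apply/funext => n; rewrite -mulrBl big_ord_recr /= addrAC subrr add0r.
Qed.

Section pathwise.
Context (R : realType) (z : R -> R) (t D : nat -> R) (mu : R).
Hypothesis t0 : t 0%N = 0.
Hypothesis t_lt : forall n, t n < t n.+1.
Hypothesis mu_gt0 : 0 < mu.
Hypothesis t_cvg : t n / n%:R @[n --> \oo] --> mu.

Let t_le : {homo t : n m / (n <= m)%N >-> n <= m}.
Proof.
move=> n m /subnKC <-; elim: (m - n)%N => [|k IH]; first by rewrite addn0.
by rewrite addnS (le_trans IH)// ltW.
Qed.

Let t_ge0 n : 0 <= t n.
Proof. by rewrite -t0 t_le. Qed.

(** t n tends to infinity because t n / n has a positive limit. *)
Lemma exists_cycle_index (s : R) : 0 <= s -> exists n, t n <= s < t n.+1.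
Proof.
move=> s0.
have [N tN] : exists N, s < t N.
  have /cvgrPdist_lt /(_ (mu / 2)) [|N _ tN] := t_cvg; first by rewrite divr_gt0.
  pose n := maxn N (Num.trunc (s / (mu / 2))).+1.
  exists n; have n0 : 0 < n%:R :> R by rewrite ltr0n leq_max orbT.
  have := tN n (leq_maxl _ _); rewrite /= ltr_distlC => /andP[+ _].
  rewrite ltr_pdivlMr// => tn; apply: lt_trans tn.
  have -> : mu - mu / 2 = mu / 2 by field.
  rewrite mulrC -ltr_pdivrMr ?divr_gt0//.
  by apply: lt_le_trans (truncnS_gt _) _; rewrite ler_nat leq_maxr.
case: (ex_minnP (ex_intro (fun n => s < t n) N tN)) => -[|m] sm min_m.
  by move: sm; rewrite t0 ltNge s0.
by exists m; rewrite sm andbT leNgt; apply/negP => /min_m; rewrite ltnn.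
Qed.

(** Let N s be the index of the cycle containing s. It tends to infinity with s,
    and z s / s is the quotient of z s / N s, which tends to b, by s / N s, which
    tends to mu. *)
Lemma cvg_of_cycle_endpoints (b : R) :
  z (t n) / n%:R @[n --> \oo] --> b -> D n / n%:R @[n --> \oo] --> 0 ->
  (forall n s, t n <= s <= t n.+1 -> `|z s - z (t n)| <= D n) ->
  z s / s @[s --> +oo] --> b / mu.
Proof.
move=> zt_cvg D_cvg zD.
have /choice[N NP] : forall s, exists n, 0 <= s -> t n <= s < t n.+1.
  move=> s; have [s0|s0] := leP 0 s; last by exists 0%N.
  by have [n ?] := exists_cycle_index s0; exists n.
have N_cvg : N s @[s --> +oo] --> \oo.
  apply/cvgnyPge => A; exists (t A); split; first exact: num_real.
  move=> s As; have s0 : 0 <= s by rewrite (le_trans (t_ge0 A))// ltW.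
  rewrite leqNgt; apply/negP => NA; have /andP[_] := NP s s0.
  by rewrite ltNge (le_trans (t_le NA))// ltW.
have good : \forall s \near +oo, [/\ 0 < s, (0 < N s)%N & t (N s) <= s < t (N s).+1].
  near=> s; have s0 : 0 < s by near: s; exact: nbhs_pinfty_gt.
  split=> //; last exact/NP/ltW.
  near: s; move/cvgnyPge: N_cvg; exact.
have tS_cvg := cvg_average_shift t_cvg.
have ratio_cvg : s / (N s)%:R @[s --> +oo] --> mu.
  apply: (@squeeze_cvgr _ _ _ _ (fun s => t (N s) / (N s)%:R)
    (fun s => t (N s).+1 / (N s)%:R)).
  - apply: filterS good => s [s0 N0 /andP[tNs stN]].
    by rewrite !ler_pM2r ?invr_gt0 ?ltr0n// tNs ltW.
  - exact: (cvg_comp N (fun n => t n / n%:R) N_cvg t_cvg).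
  - exact: (cvg_comp N (fun n => t n.+1 / n%:R) N_cvg tS_cvg).
have num_cvg : z s / (N s)%:R @[s --> +oo] --> b.
  have DN := cvg_comp N (fun n => D n / n%:R) N_cvg D_cvg.
  have zN := cvg_comp N (fun n => z (t n) / n%:R) N_cvg zt_cvg.
  apply: (@squeeze_cvgr _ _ _ _
    (fun s => z (t (N s)) / (N s)%:R - D (N s) / (N s)%:R)
    (fun s => z (t (N s)) / (N s)%:R + D (N s) / (N s)%:R)).
  - apply: filterS good => s [s0 N0 /andP[tNs stN]].
    have := zD (N s) s; rewrite tNs ltW// => /(_ isT).
    rewrite ler_distl => /andP[lo hi].
    by rewrite -mulrBl -mulrDl !ler_pM2r ?invr_gt0 ?ltr0n// lo hi.
  - by rewrite -[b]subr0; exact: cvgB.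
  - by rewrite -[b]addr0; exact: cvgD.
have quot_cvg : z s / (N s)%:R * (s / (N s)%:R)^-1 @[s --> +oo] --> b / mu.
  by apply: cvgM => //; apply: cvgV => //; exact: lt0r_neq0.
apply: cvg_trans quot_cvg; apply: near_eq_cvg.
apply: filterS good => s [s0 N0 _] /=.
by field; rewrite !lt0r_neq0 ?ltr0n.
Unshelve. all: by end_near. Qed.

(** Eventually |z s| <= (|a| + 1) s and t (n + 1) <= (mu + 1) (n + 1), and the
    oscillation is at most |z s| + |z (t n)|. The constant depends on the limits a
    and mu only. *)
Lemma cycle_oscillation_linear (a : R) : z s / s @[s --> +oo] --> a ->
  \forall n \near \oo, forall s, t n <= s <= t n.+1 ->
    `|z s - z (t n)| <= 2 * (`|a| + 1) * (mu + 1) * n.+1%:R.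
Proof.
move=> z_cvg.
have tnear : \forall n \near \oo, t n.+1 <= (mu + 1) * n.+1%:R.
  have /cvgrPdist_le /(_ 1 ltr01) := cvg_average_succ t_cvg.
  apply: filterS => n; rewrite ler_distlC => /andP[_].
  by rewrite ler_pdivrMr.
have znear : \forall s \near +oo, `|z s| <= (`|a| + 1) * s.
  have /cvgrPdist_le /(_ 1 ltr01) near1 := z_cvg.
  near=> s; have s0 : 0 < s by near: s; exact: nbhs_pinfty_gt.
  have dist : `|a - z s / s| <= 1 by near: s; exact: near1.
  rewrite -ler_pdivrMr// -[X in _ / X](ger0_norm (ltW s0)) -normf_div.
  rewrite -[z s / s](subrK a) (le_trans (ler_normD _ _))// addrC lerD2l.
  by rewrite distrC.
have [A [_ zA]] := znear.
have tA : \forall n \near \oo, A < t n.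
  have [k /andP[_ Ak]] := exists_cycle_index (normr_ge0 A).
  exists k.+1 => // n /= kn; apply: le_lt_trans (ler_norm _) _.
  exact: lt_le_trans Ak (t_le kn).
near=> n => s /andP[ts st].
have An : A < t n by near: n.
have tn : t n.+1 <= (mu + 1) * n.+1%:R by near: n.
have zs := zA s (lt_le_trans An ts); have zt := zA _ An.
apply: le_trans (ler_normB _ _) _.
apply: le_trans (lerD zs zt) _.
rewrite -mulrDr -!mulrA mulrCA ler_wpM2l// ?addr_ge0//.
have := le_trans ts st; lra.
Unshelve. all: by end_near. Qed.

End pathwise.

(** * The cycles of a regenerative process *)

Lemma expectation_gt0 (R : realType) (d : measure_display)
    (T : measurableType d) (P : probability T R) (X : {RV P >-> R}) :
  (forall w, 0 < X w) -> P.-integrable setT (fun w => (X w)%:E) ->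
  0 < fine 'E_P[X]%E.
Proof.
move=> X0 X_int.
have EX : 'E_P[X]%E \is a fin_num.
  by rewrite expectation_fin_num//; exact/Lfun1_integrable.
rewrite -lte_fin fineK// lt_neqAle expectation_ge0 ?andbT => [|w]; last exact: ltW.
apply/negP => /eqP EX0.
have mX : measurable_fun [set: T] (fun w => (X w)%:E).
  by apply/measurable_EFinP; exact: measurable_funPT.
have : (\int[P]_w `|(X w)%:E| = 0)%E.
  transitivity 'E_P[X]%E; last exact/esym.
  by rewrite unlock; apply: eq_integral => w _ /=; rewrite gtr0_norm.
move/(ae_eq_integral_abs _ measurableT mX) => aeX0.
have : P.-negligible [set: T].
  apply: negligibleS aeX0 => w _ /= /(_ Logic.I) /eqP.
  by rewrite eqe gt_eqF.
move/(negligibleP _ measurableT) => PT0.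
by have := @probability_setT _ _ _ P; rewrite PT0 => /eqP; rewrite eq_sym onee_eq0.
Qed.

Section cycles.
Context (R : realType) (d : measure_display) (T : measurableType d).
Context (xi : nat -> T -> R) (Z : R -> T -> R).
Hypothesis xi_gt0 : forall n w, 0 < xi n w.
Hypothesis Z_cadlag : forall w, cadlag (fun t => Z t w).

Local Notation time := (renewal_time xi).
Local Notation cycle := (cycle_increment xi Z).

Lemma renewal_time0 w : time 0 w = 0.
Proof. by rewrite /renewal_time big_ord0. Qed.

Lemma renewal_timeS n w : time n.+1 w = time n w + xi n w.
Proof. by rewrite /renewal_time big_ord_recr. Qed.

Lemma renewal_time_ge0 n w : 0 <= time n w.
Proof. by apply: sumr_ge0 => i _; exact/ltW. Qed.

Lemma cycle_endE n w :
  cycle_end (cycle n w) = Z (time n.+1 w) w - Z (time n w) w.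
Proof.
rewrite /cycle_end /= min_r; first by rewrite renewal_timeS (addrC (xi n w)).
by apply: le_trans (ler_norm _) (ltW (truncnS_gt _)).
Qed.

(** The supremum over rational times bounds the displacement at every time s of
    the cycle: before the end of the cycle s is approached from the right by times
    of the form rational offset + start, and at the end the stopped path already
    has the final value at any later rational offset. *)
Lemma cycle_sup_bounds n w (s : R) : time n w <= s <= time n.+1 w ->
  (`|Z s w - Z (time n w) w|%:E <= cycle_sup (cycle n w))%E.
Proof.
rewrite renewal_timeS => /andP[ns sn].
pose t := s - time n w; have sE : s = t + time n w by rewrite subrK.
have t0 : 0 <= t by rewrite subr_ge0.
have tx : t <= xi n w by rewrite lerBlDl.
pose u k := Num.min (upper_approx k t) (xi n w) + time n w.
have u_le k : (`|Z (u k) w - Z (time n w) w|%:E <= cycle_sup (cycle n w))%E.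
  exact: (cycle_sup_ge (cycle n w)).
have [xt|tx'] := leP (xi n w) t.
  have tE : t = xi n w by apply/eqP; rewrite eq_le tx.
  have := u_le 0%N; rewrite /u min_r; first by rewrite -tE -sE.
  by rewrite -tE ltW// upper_approx_gt.
have s0 : 0 <= s by rewrite (le_trans (renewal_time_ge0 n w)).
have u_cvg : u k @[k --> \oo] --> s.
  rewrite sE; apply: cvgD; last exact: cvg_cst.
  apply: (@squeeze_cvgr _ _ _ _ (cst t) (fun k => upper_approx k t)).
  - apply: nearW => k.
    by rewrite le_min tx (ltW (upper_approx_gt _ _)) ge_min lexx.
  - exact: cvg_cst.
  - exact: upper_approx_cvg.
have Zu : Z (u k) w @[k --> \oo] --> Z s w.
  have [/(_ _ s0)/cvg_at_rightP Zright _] := Z_cadlag w; apply: Zright; split => // k.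
  by rewrite sE ltrD2r lt_min tx' upper_approx_gt.
have ZuE : (`|Z (u k) w - Z (time n w) w|%:E @[k --> \oo] -->
            `|Z s w - Z (time n w) w|%:E)%E.
  apply: cvg_EFin; first exact: nearW.
  by apply: cvg_norm; apply: cvgB => //; exact: cvg_cst.
by apply: (cvge_to_le ZuE); exact: nearW.
Qed.

Lemma cycle_sup_first (Z0 : forall w, Z 0 w = 0) w :
  cycle_sup (cycle 0 w) = first_cycle_max xi Z w.
Proof.
have time1 : time 1 w = xi 0%N w by rewrite renewal_timeS renewal_time0 add0r.
apply/eqP; rewrite eq_le; apply/andP; split.
  apply: cycle_sup_le => t t0 /=; rewrite renewal_time0 Z0 subr0 addr0.
  apply: ereal_sup_ubound; exists (Num.min t (xi 0%N w)) => //=.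
  by rewrite in_itv /= time1 le_min t0 (ltW (xi_gt0 _ _)) ge_min lexx orbT.
apply: ge_ereal_sup => _ [s /= + <-]; rewrite in_itv /= => s01.
have := @cycle_sup_bounds 0 w s; rewrite renewal_time0 Z0 subr0; exact.
Qed.

Hypothesis mxi : forall n, measurable_fun [set: T] (xi n).
Hypothesis mZ : forall t, measurable_fun [set: T] (Z t).

Lemma measurable_renewal_time n : measurable_fun [set: T] (time n).
Proof. by apply: measurable_sum. Qed.

(** It suffices to look at the evaluations of the stopped path, and these involve
    Z at random times only. *)
Lemma measurable_cycle n : measurable_fun [set: T] (cycle n).
Proof.
have mtime := measurable_renewal_time n.
apply/measurable_fun_pairP; split; first exact: mxi.
apply: (@measurability _ _ T (path_space R) setT _ (@evaluation_cylinders R)) => //.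
move=> _ [_ [t [B [t0 mB ->]]] <-].
rewrite setTI.
rewrite [X in measurable X](_ : _ = [set: T] `&`
  (fun w => Z (Num.min t (xi n w) + time n w) w - Z (time n w) w) @^-1` B).
  apply: measurable_funB => //; apply: measurable_random_time => //.
  - by apply: measurable_funD => //; exact: measurable_minr.
  - by move=> w; rewrite addr_ge0 ?renewal_time_ge0// le_min t0 ltW.
  - by move=> w; exact: renewal_time_ge0.
by rewrite setTI.
Qed.

End cycles.

(** * The strong law for regenerative increments *)

Section regenerative_slln.
Context (R : realType) (d : measure_display) (T : measurableType d).
Context (P : probability T R) (xi : nat -> {RV P >-> R}) (Z : R -> {RV P >-> R}).
Hypothesis renewal : interarrival_times xi.
Hypothesis Z_cadlag : forall w : T, cadlag (fun t : R => Z t w).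
Hypothesis Z_regenerative : regenerative_increments xi Z.

Local Notation time := (renewal_time (fun n => xi n : T -> R)).
Local Notation cycle :=
  (cycle_increment (fun n => xi n : T -> R) (fun t => Z t : T -> R)).

Let xi_gt0 n w : 0 < xi n w. Proof. by case: renewal. Qed.
Let iid_xi : iid P (fun n => xi n : T -> R). Proof. by case: renewal. Qed.
Let Z0 w : Z 0 w = 0. Proof. by case: Z_regenerative. Qed.
Let iid_cycle : iid P cycle. Proof. by case: Z_regenerative. Qed.

Let mcycle n : measurable_fun [set: T] (cycle n).
Proof. by apply: measurable_cycle => // *; exact: measurable_funPT. Qed.

Let time_lt w n : time n w < time n.+1 w.
Proof. by rewrite renewal_timeS ltrDl. Qed.

Hypothesis xi_int : P.-integrable setT (fun w => (xi 0%N w)%:E).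

Let mean_gt0 : 0 < fine 'E_P[xi 0%N]%E.
Proof. exact: (expectation_gt0 (xi_gt0 0) xi_int). Qed.

Let time_cvg :
  {ae P, forall w, time n w / n%:R @[n --> \oo] --> fine 'E_P[xi 0%N]%E}.
Proof. exact: (slln iid_xi xi_int). Qed.

(** The event B n is cycle_sup > C (n + 1), for the constant C of
    cycle_oscillation_linear, which is the same for almost all paths. *)
Lemma cycle_sup_integral_lty_of_slln (a : R) :
  {ae P, forall w, Z t w / t @[t --> +oo] --> a} ->
  (\int[P]_w cycle_sup (cycle 0 w) < +oo)%E.
Proof.
move=> Z_cvg; pose C := 2 * (`|a| + 1) * (fine 'E_P[xi 0%N]%E + 1).
have C0 : 0 < C by rewrite !mulr_gt0// addr_gt0.
pose B n := [set c : R * path_space R | ((C * n.+1%:R)%:E < cycle_sup c)%E].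
have mB n : measurable (B n).
  rewrite -[B n]setTI; apply: emeasurable_fun_o_infty => //.
  exact: measurable_cycle_sup.
apply: (integral_lty_tail_sum (C := C)) => //.
- by apply: measurableT_comp (mcycle 0); exact: measurable_cycle_sup.
- have : (\sum_(0 <= n <oo) P (cycle n @^-1` B n) < +oo)%E.
    apply: borel_cantelli_indep => //; first by case: iid_cycle.
    apply: filterS2 time_cvg Z_cvg => w tw Zw.
    have := cycle_oscillation_linear (renewal_time0 _ w) (time_lt w) mean_gt0 tw Zw.
    apply: filterS => n osc; apply/negP; rewrite -leNgt.
    apply: cycle_sup_le => t t0; rewrite lee_fin; apply: osc.
    by rewrite renewal_timeS addrC lerDl lerD2l le_min t0 ltW//= ge_min lexx orbT.
  congr (_ < _)%E; apply: eq_eseriesr => n _.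
  by case: iid_cycle => _ /(_ n 0%N (B n) (mB n)).
- by move=> w; exact: cycle_sup_ge0.
Qed.

Hypothesis end_int :
  P.-integrable setT (fun w => (cycle_end (cycle 0 w))%:E).

(** The strong law is applied to the cycle lengths, to the increments W n and to
    the maxima D n. The latter are made real-valued by fine, which changes them on
    a null set only, because they are integrable. *)
Lemma slln_of_cycle_sup_integral_lty :
  (\int[P]_w cycle_sup (cycle 0 w) < +oo)%E ->
  {ae P, forall w, Z t w / t @[t --> +oo] -->
    fine (\int[P]_w (cycle_end (cycle 0 w))%:E)%E / fine 'E_P[xi 0%N]%E}.
Proof.
move=> sup_lty.
have msup : measurable_fun [set: T] (fun w => cycle_sup (cycle 0 w)).
  by apply: measurableT_comp (mcycle 0); exact: measurable_cycle_sup.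
have sup_int : P.-integrable setT (fun w => cycle_sup (cycle 0 w)).
  apply/integrableP; split => //.
  by under eq_integral do rewrite gee0_abs ?cycle_sup_ge0//.
have mfine : measurable_fun setT (fine \o @cycle_sup R).
  by apply: measurableT_comp => //; exact: measurable_cycle_sup.
pose W n : {RV P >-> R} :=
  mfun_Sub (mem_set (measurableT_comp (@measurable_cycle_end R) (mcycle n))).
pose D n : {RV P >-> R} := mfun_Sub (mem_set (measurableT_comp mfine (mcycle n))).
have EW : ('E_P[W 0%N] = \int[P]_w (cycle_end (cycle 0 w))%:E)%E by rewrite unlock.
have iidW : iid P (fun n => W n : T -> R).
  exact: (iid_comp (@measurable_cycle_end R) iid_cycle).
have iidD : iid P (fun n => D n : T -> R) by exact: (iid_comp mfine iid_cycle).
have D_int : P.-integrable setT (fun w => (D 0%N w)%:E).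
  apply: le_integrable sup_int => //.
    by apply/measurable_EFinP; exact: measurable_funPT.
  move=> w _ /=; have := cycle_sup_ge0 (cycle 0 w).
  by case: (cycle_sup _) => //= *; rewrite normr0 leey.
have sup_fin : {ae P, forall w, forall n, cycle_sup (cycle n w) = (D n w)%:E}.
  apply/ae_foralln => n.
  pose B := (@cycle_sup R) @^-1` [set +oo%E].
  have mB : measurable B.
    by rewrite -[B]setTI; exact: measurable_cycle_sup.
  exists (cycle n @^-1` B); split.
  - by rewrite -[X in measurable X]setTI; exact: mcycle.
  - transitivity (P (cycle 0 @^-1` B)).
      by case: iid_cycle => _ /(_ n 0%N B mB).
    apply/(negligibleP _ _).
      by rewrite -[X in measurable X]setTI; exact: mcycle.
    apply: negligibleS (integrable_ae measurableT sup_int) => w /= supy.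
    by move=> /(_ Logic.I); rewrite supy.
  - move=> w /=; have := cycle_sup_ge0 (cycle n w); rewrite /B /=.
    by case: (cycle_sup _) => //= *; apply: contrapT.
have cvgW := slln iidW end_int.
have cvgD := slln iidD D_int.
apply: filterS2 (filterI time_cvg sup_fin) (filterI cvgW cvgD).
move=> w [tw supE] [Ww Dw].
have ZE n : Z (time n w) w = \sum_(i < n) W i w.
  elim: n => [|n IH]; first by rewrite renewal_time0 Z0 big_ord0.
  rewrite big_ord_recr -IH.
  have -> : W n w = Z (time n.+1 w) w - Z (time n w) w.
    exact: (@cycle_endE R d T (fun n => xi n : T -> R) (fun t => Z t : T -> R)).
  by rewrite /= addrC subrK.
apply: (cvg_of_cycle_endpoints (renewal_time0 _ w) (time_lt w) mean_gt0 tw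
  (D := fun n => D n w)).
- by under eq_fun do rewrite ZE; rewrite -EW; exact: Ww.
- exact: (cvg_average_term (u := fun n => D n w) Dw).
- move=> n s ns; rewrite -lee_fin -supE.
  exact: (cycle_sup_bounds (xi := fun n => xi n : T -> R) (Z := fun t => Z t : T -> R)).
Qed.

End regenerative_slln.

Theorem mainTheorem4 (R : realType) (d : measure_display)
    (T : measurableType d) (P : probability T R)
    (xi : nat -> {RV P >-> R}) (Z : R -> {RV P >-> R})
    (T_1 := renewal_time (fun n => xi n : T -> R) 1)
    (Z_T1 := fun w : T => Z (T_1 w) w)
    (M_1 := first_cycle_max (fun n => xi n : T -> R) (fun t => Z t : T -> R))
    (a := fine 'E_P[Z_T1]%E / fine 'E_P[T_1]%E)
    (renewal : interarrival_times xi)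
    (Z_cadlag : forall w : T, cadlag (fun t : R => Z t w))
    (Z_regenerative : regenerative_increments xi Z)
    (T_1_integrable : P.-integrable setT (fun w : T => (T_1 w)%:E))
    (Z_T1_integrable : P.-integrable setT (fun w : T => (Z_T1 w)%:E)) :
  {ae P, forall w : T, Z t w / t @[t --> +oo] --> a}
  <-> (\int[P]_w M_1 w < +oo)%E.
Proof.
pose cycle0 := cycle_increment (fun n => xi n : T -> R) (fun t => Z t : T -> R) 0.
have T_1E : T_1 = xi 0%N.
  by apply/funext => w; rewrite /T_1 renewal_timeS renewal_time0 add0r.
have Z_T1E : Z_T1 = (fun w => cycle_end (cycle0 w)).
  apply/funext => w; rewrite cycle_endE renewal_time0.
  by case: Z_regenerative => -> _; rewrite subr0.
have M_1E : M_1 = (fun w => cycle_sup (cycle0 w)).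
  apply/funext => w; apply/esym/cycle_sup_first => //.
  - by move=> n v; case: renewal.
  - by case: Z_regenerative.
have EZ : ('E_P[Z_T1] = \int[P]_w (cycle_end (cycle0 w))%:E)%E.
  by rewrite unlock Z_T1E.
have xi_int : P.-integrable setT (fun w => (xi 0%N w)%:E) by rewrite -T_1E.
rewrite M_1E; split; first exact: cycle_sup_integral_lty_of_slln.
move=> sup_lty; rewrite /a EZ T_1E.
by apply: slln_of_cycle_sup_integral_lty => //; move: Z_T1_integrable; rewrite Z_T1E.
Qed.
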